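(* The $5$-wheel $W_5$ is common; that is, $$\liminf_{n\to\infty}\ \min_{G\in\mathcal M_n}\bigl(t(W_5;G)+t(W_5;G^\ast)\bigr)\ \ge\ 2^{1-|E(W_5)|}=2^{-9}.$$
   Context: All graphs are finite and simple (no loops, no multiple edges). For a natural number $n$, $\mathcal M_n$ denotes the set of all simple graphs on $n$ vertices up to isomorphism. $V(G)$ and $E(G)$ denote the vertex set and edge set of a graph $G$, and $G^\ast$ denotes the complement of $G$ (same vertex set; two distinct vertices are adjacent in $G^\ast$ if and only if they are not adjacent in $G$). The homomorphism density $t(H;G)$ of a graph $H$ in a graph $G$ is the probability that a uniformly random map $V(H)\to V(G)$ (not necessarily injective) is a graph homomorphism, i.e. maps every edge of $H$ to an edge of $G$. A graph $H$ is called common if $$\liminf_{n\to\infty}\ \min_{G\in\mathcal M_n}\bigl(t(H;G)+t(H;G^\ast)\bigr)\ \ge\ 2^{1-|E(H)|}.$$ The $5$-wheel $W_5$ is the graph on $6$ vertices consisting of a cycle of length $5$ together with one additional vertex adjacent to all five vertices of the cycle; it has $10$ edges. *)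

(* Defs.v *)
From HB Require Import structures.
From mathcomp Require Import all_boot all_order all_algebra.
From mathcomp Require Import all_classical all_reals all_analysis.
Set Implicit Arguments.
Unset Strict Implicit.
Unset Printing Implicit Defensive.
Import Order.TTheory GRing.Theory Num.Theory.
Local Open Scope ring_scope.
Local Open Scope set_scope.

(* A finite simple graph on the vertex type V is its set of edges, an edge
   being an unordered pair of distinct vertices. *)
Record sgraph (V : finType) := SGraph {
  edges : {set {set V}};
  edgesP : [forall e in edges, #|e| == 2%N] }.

Section SGraph.
Variable V : finType.

HB.instance Definition _ := [isSub for @edges V].
HB.instance Definition _ := [Finite of sgraph V by <:].

Fact edgeless_subproof : [forall e in (finset.set0 : {set {set V}}), #|e| == 2%N].
Proof. by apply/forall_inP => e; rewrite inE. Qed.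

Definition edgeless : sgraph V := SGraph edgeless_subproof.

Fact compl_subproof (G : sgraph V) :
  [forall e in [set e : {set V} | #|e| == 2%N & e \notin edges G],
     #|e| == 2%N].
Proof. by apply/forall_inP => e; rewrite inE => /andP[]. Qed.

Definition compl (G : sgraph V) : sgraph V := SGraph (compl_subproof G).

End SGraph.

Section Density.
Variables (R : realType) (V : finType).
Implicit Type H : sgraph V.

(* Since edges of G have exactly two elements, f @: [set x; y] \in edges G
   holds iff f x and f y are distinct and adjacent. *)
Definition is_hom (W : finType) H (G : sgraph W) (f : {ffun V -> W}) : bool :=
  [forall e in edges H, f @: e \in edges G].

Definition hom_density (W : finType) H (G : sgraph W) : R :=
  #|[set f : {ffun V -> W} | is_hom H G f]|%:R / #|{: {ffun V -> W}}|%:R.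

(* Every isomorphism class of graphs on n vertices is represented by a graph on
   'I_n, and the quantity being minimized is an isomorphism invariant, so the
   minimum may be taken over the (finite, nonempty) type of graphs on 'I_n. *)
Definition min_density H (n : nat) : R :=
  let F (G : sgraph 'I_n) := hom_density H G + hom_density H (compl G) in
  F [arg min_(G < edgeless 'I_n) F G]%O.

Definition common H : Prop :=
  ((2 ^ (1 - #|edges H|%:Z))%:E <=
   limn_einf (fun n : nat => (min_density H n)%:E))%E.

End Density.

(* The vertices of the 5-wheel are the hub None and the rim vertices Some i;
   ordS is the cyclic successor i |-> i + 1 mod 5. *)
Definition W5_edges : {set {set option 'I_5}} :=
  [set [set Some i; Some (ordS i)] | i : 'I_5]
    :|: [set [set None; Some i] | i : 'I_5].

Fact W5_subproof : [forall e in W5_edges, #|e| == 2%N].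
Proof.
apply/forall_inP => e /finset.setUP[] /imsetP[i _ ->]; rewrite cards2 //.
by case: i => [[|[|[|[|[|]]]]] ?].
Qed.

Definition W5 : sgraph (option 'I_5) := SGraph W5_subproof.

(* Main.v *)
(** Put [f u v = 1] if [uv] is an edge of [G] and [f u v = -1] otherwise, loops
    included.  Up to the maps that collapse an edge of [W5], a proportion
    [O(1/n)] of all maps, [2^10 (t(W5; G) + t(W5; G'))], with [G'] the
    complement of [G], is the average over [x : V(W5) -> V(G)] of
    [prod_e (1 + f_e) + prod_e (1 - f_e)], where [e] runs over the edges of
    [W5] and [f_e = f (x i) (x j)] for [e = ij].  So it is enough to bound this
    average from below by [2], for every symmetric [f] with [f^2 = 1].

    As [f^2 = 1], every polynomial in the fifteen values [f_e] is a combination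
    of monomials [prod_(e in F) f_e] over graphs [F] on six vertices.  The
    average of a monomial depends only on the isomorphism class of [F], and the
    monomials with [F] odd cancel between [f] and [-f].

    Lower bounds come from squares: let [w x = prod_e (1 + c_e f_e)], over the
    pairs [e] in [{0, 1, 2, 3}] with signs [c_e], and let
    [L x u = sum_S v_S prod_(i in S) f (x i) u] over subsets [S] of
    [{0, 1, 2, 3}].  Averaging [w x * L x (x 4) * L x (x 5)] over [x 4] and
    [x 5] gives a nonnegative multiple of a square.  Modulo isomorphism and odd
    monomials, [d (prod_e (1 + f_e) - 1)] is a sum of 71 such expressions with
    positive coefficients. *)
From Stdlib Require Import BinInt.
Require Import Defs.
From mathcomp Require Import all_boot all_order all_algebra.
From mathcomp Require Import all_classical all_reals all_analysis.
From mathcomp Require Import ssrZ ring.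
Set Implicit Arguments.
Unset Strict Implicit.
Unset Printing Implicit Defensive.
Import Order.TTheory GRing.Theory Num.Theory.

Delimit Scope Z_scope with BZ.

(** * Polynomials in fifteen sign variables *)

(* The k-th bit says whether the k-th pair of [pairs6] is in the graph; trailing
   [false] bits may be omitted. *)
Definition monomial := bitseq.
Definition poly6 := seq (Z * monomial).

(** The variables square to [1], so monomials multiply by symmetric difference of their graphs. *)
Fixpoint xorm (m1 m2 : monomial) : monomial :=
  match m1, m2 with
  | [::], _ => m2
  | _, [::] => m1
  | b1 :: m1', b2 :: m2' => (b1 (+) b2) :: xorm m1' m2'
  end.

Definition scalep (c : Z) (p : poly6) : poly6 := [seq (Z.mul c t.1, t.2) | t <- p].

Definition mulp (p q : poly6) : poly6 :=
  flatten [seq [seq (Z.mul s.1 t.1, xorm s.2 t.2) | t <- q] | s <- p].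

(** The path to a node spells a monomial, with [false] to the left, and the node holds its
    coefficient. Inserting terms one by one thus merges like monomials quickly. *)
Inductive trie := Leaf | Node of Z & trie & trie.

Fixpoint insert (c : Z) (m : monomial) (t : trie) : trie :=
  match m, t with
  | [::], Leaf => Node c Leaf Leaf
  | [::], Node c' l r => Node (Z.add c c') l r
  | b :: m', Leaf =>
      if b then Node Z0 Leaf (insert c m' Leaf)
      else Node Z0 (insert c m' Leaf) Leaf
  | b :: m', Node c' l r =>
      if b then Node c' l (insert c m' r) else Node c' (insert c m' l) r
  end.

Definition consm (b : bool) (p : poly6) : poly6 := [seq (t.1, b :: t.2) | t <- p].

Fixpoint terms (t : trie) : poly6 :=
  if t is Node c l r then
    let rest := consm false (terms l) ++ consm true (terms r) in
    if Z.eqb c Z0 then rest else (c, [::]) :: rest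
  else [::].

Definition collect (p : poly6) : poly6 :=
  terms (foldl (fun t s => insert s.1 s.2 t) Leaf p).

(** * Graphs on six vertices and their relabellings *)

Definition pairs6 : seq (nat * nat) :=
  [:: (0, 1); (0, 2); (0, 3); (1, 2); (1, 3); (2, 3);
      (0, 4); (1, 4); (2, 4); (3, 4); (0, 5); (1, 5); (2, 5); (3, 5); (4, 5)].

Definition pair_index (i j : nat) : nat :=
  index (if i < j then (i, j) else (j, i)) pairs6.

Definition on_pairs (s : seq nat) : seq nat :=
  [seq pair_index (nth 0 s e.1) (nth 0 s e.2) | e <- pairs6].

Definition relabel (pi : seq nat) (m : monomial) : monomial :=
  [seq nth false m k | k <- pi].

Fixpoint ltm (m1 m2 : monomial) : bool :=
  match m1, m2 with
  | b1 :: m1', b2 :: m2' => if b1 == b2 then ltm m1' m2' else b2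
  | [::], _ :: _ => true
  | _, [::] => false
  end.

Definition valid_perm (s : seq nat) : bool :=
  let pi := on_pairs s in
  [&& size s == 6, all (gtn 6) s, uniq s, uniq pi & all (gtn 15) pi].

(* Relabelling preserves the average of a monomial, so each term may be replaced
   by the smaller of itself and its relabelling; isomorphic terms then merge. *)
Definition fold_by (s : seq nat) (p : poly6) : poly6 :=
  let pi := on_pairs s in
  collect [seq (t.1, let m := relabel pi t.2 in if ltm m t.2 then m else t.2)
             | t <- p].

(* [relabel (iota 0 15)] pads a monomial to length 15. *)
Definition parity (m : monomial) : bool :=
  foldr addb false (relabel (iota 0 15) m).

Definition even_part (p : poly6) : poly6 :=
  [seq (t.1, relabel (iota 0 15) t.2) | t <- p & ~~ parity t.2].

(** * The wheel polynomial and the sums of squares *)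

Definition bit (k : nat) : monomial := ncons k false [:: true].

Definition one_plus (c : Z) (k : nat) : poly6 := [:: (1%BZ, [::]); (c, bit k)].

Definition prodp (ps : seq poly6) : poly6 := foldr mulp [:: (1%BZ, [::])] ps.

Definition wheel_pairs : seq nat :=
  [seq pair_index i (i.+1 %% 5) | i <- iota 0 5]
  ++ [seq pair_index i 5 | i <- iota 0 5].

Definition wheel_poly : poly6 := prodp [seq one_plus 1 k | k <- wheel_pairs].

Definition pattern (c : seq Z) : poly6 :=
  prodp [seq one_plus (nth 0%BZ c k) k | k <- iota 0 6].

(* The characteristic vector of a subset of {0, 1, 2, 3}, coded in binary by [i]. *)
Definition bits4 (i : nat) : bitseq :=
  [:: odd i; odd i./2; odd i./2./2; odd i./2./2./2].

(* Entry [i - 1] of [v] is the coefficient of the subset coded by [i]; in [pairs6],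
   the pairs joining {0, 1, 2, 3} to 4 start at [k = 6], and those to 5 at [k = 10].
   The full set [i = 15] does not occur. *)
Definition linear (v : seq Z) (k : nat) : poly6 :=
  [seq (nth Z0 v i.-1, ncons k false (bits4 i))
     | i <- iota 1 14 & ~~ Z.eqb (nth Z0 v i.-1) 0].

Definition square (v : seq Z) : poly6 := mulp (linear v 6) (linear v 10).

Definition squares (sq : seq (Z * seq Z)) : poly6 :=
  collect (flatten [seq scalep t.1 (square t.2) | t <- sq]).

Definition sos (cert : seq (seq Z * seq (Z * seq Z))) : poly6 :=
  flatten [seq mulp (pattern b.1) (squares b.2) | b <- cert].

Definition valid_sos (cert : seq (seq Z * seq (Z * seq Z))) : bool :=
  all (fun b => all (fun c => Z.leb (Z.abs c) 1) b.1 &&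
                all (fun t => Z.leb 0 t.1) b.2) cert.

Definition difference (d : Z) (p : poly6) cert : poly6 :=
  even_part (scalep d p ++ [:: (Z.opp d, [::])] ++ scalep (Zneg xH) (sos cert)).

Definition no_terms (p : poly6) : bool := if p is [::] then true else false.

Definition certifies (d : Z) (p : poly6) cert (ss : seq (seq nat)) : bool :=
  [&& Z.ltb 0 d, valid_sos cert, all valid_perm ss
    & no_terms
        (foldl (fun q s => fold_by s q) (collect (difference d p cert)) ss)].

(** * The certificate and its verification *)

Definition scale : Z := 104141495443806480467953109962140672.

(* Each block is a sign pattern on the six pairs in {0, 1, 2, 3}, up to symmetry
   a colouring of K4, followed by weighted squares.  It was found by solving the
   semidefinite relaxation numerically, rounding eigenvectors of the dual to small
   integer vectors, and solving a linear program for the weights exactly. *)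
Definition certificate : seq (seq Z * seq (Z * seq Z)) := [::
  ([:: 1; 1; 1; 1; 1; 1], [::
    (15043123841800890534290758728295104, [:: 1; 0; 0; 0; 0; 0; 0; 0; 0; 0; 0; 0; 0; 0]);
    (27085817760966128431243661683406940, [:: 1; 0; 0; 0; 0; 0; 0; -1; 0; 0; 0; 0; 0; 0]);
    (1285954086496205794959681181492040, [:: 1; 0; 0; 0; 0; 0; 0; 0; 0; 0; 0; 0; 0; -1]);
    (2382083667882294381207947861268348, [:: 3; 3; 1; 3; 1; 1; 0; 3; 1; 1; 0; 1; 0; 0]);
    (355266348207756280430911059277012, [:: 1; 1; 0; 1; 0; 0; -1; 1; 0; 0; -1; 0; -1; -1]);
    (1804535855188513923701724312530448, [:: 2; 2; 1; 2; 1; 1; 1; 2; 1; 1; 1; 1; 1; 1]);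
    (602276148866822218280168763778572, [:: 3; 3; 1; 3; 1; 1; 1; 3; 1; 1; 1; 1; 1; 1])]);
  ([:: -1; 1; 1; 1; 1; 1], [::
    (71072210666847554222676776650649928, [:: 1; 0; 0; 0; 0; 0; 0; 0; 0; 0; 0; 0; 0; 0]);
    (2284269213158113208864650267160856, [:: 0; 0; 0; 1; 0; 0; 0; 0; 0; 0; 0; 0; 0; 0]);
    (13187179000780562753894110474504248, [:: 1; -1; 0; 0; 0; 0; 0; 0; 0; 0; 0; 0; 0; 0]);
    (90251417465703985256424080447430456, [:: 1; 0; 0; 0; 0; 0; 0; -1; 0; 0; 0; 0; 0; 0]);
    (2599351675377479702470583013060312, [:: 0; 0; 0; 0; 1; 0; 0; 0; -1; 0; 0; 0; 0; 0]);
    (1974738322733304996925697156972994, [:: 0; 0; 0; 1; 1; 1; 0; -1; -1; -1; 0; 0; 0; 0]);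
    (4642992889300884676367277336147384, [:: 1; -1; 0; 0; 1; -1; 0; 0; 1; -1; 0; 0; 1; -1]);
    (1483487494706397491099445737987946, [:: 3; -3; 0; 0; 1; -1; 0; 0; 1; -1; 0; 0; 0; 0]);
    (22284444254122216213098502275215238, [:: 1; 1; 0; -1; 0; 0; 0; -1; 0; 0; 0; 0; 0; 0]);
    (1185653021208292568866144928319288, [:: 2; 2; -1; -3; 0; 0; 0; -3; 0; 0; 0; -1; 0; 0]);
    (3558656957423778455585494763613816, [:: 2; 2; 0; 2; 1; 1; 0; 2; 1; 1; 0; 1; 0; 0]);
    (3706992220791921850103953723595592, [:: 3; 3; 0; 3; 1; 1; 1; 3; 1; 1; 1; 1; 1; 1]);
    (1784677708469235612674217802744464, [:: 0; 0; 1; 0; 0; 0; 2; 0; 0; 0; 2; 1; 1; 1]);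
    (1631759663565196339570461956859396, [:: 0; 0; 0; 2; 1; 1; 1; -2; -1; -1; -1; 0; 0; 0]);
    (2200523136238913542147319516946156, [:: 0; 0; 0; 3; 1; 1; 1; -3; -1; -1; -1; 0; 0; 0]);
    (11024102198405324075563355862664824, [:: 2; 2; 0; 1; 1; 1; 0; 1; 1; 1; 0; 0; 0; 0]);
    (493566722286029014297066985648448, [:: 1; 1; -1; 0; 0; 0; -2; 0; 0; 0; -2; 0; -1; -1]);
    (1630126231246530361218255115642788, [:: 0; 0; 0; 1; -1; -1; 0; -1; 1; 1; 0; 0; 0; 0])]);
  ([:: -1; -1; 1; 1; 1; 1], [::
    (129559507813749944246386427862428352, [:: 1; 0; 0; 0; 0; 0; 0; 0; 0; 0; 0; 0; 0; 0]);
    (17251984538162922193544040553361760, [:: 0; 1; 0; 0; 0; 0; 0; 0; 0; 0; 0; 0; 0; 0]);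
    (42102985966455440248749104271688392, [:: 1; 1; 0; 0; 0; 0; 0; 0; 0; 0; 0; 0; 0; 0]);
    (12872432081478336555478132141323936, [:: 1; 0; 0; 0; 0; 0; -1; 0; 0; 0; 0; 0; 0; 0]);
    (2811421351266029030442239774068920, [:: 1; 0; 0; 0; 0; 0; 0; -1; 0; 0; 0; 0; 0; 0]);
    (15325221842752205455083749921719248, [:: 1; 0; 0; 0; 0; 0; 0; 0; 0; 0; 0; -1; 0; 0]);
    (77868843681042729118981591428071352, [:: 0; 1; 0; 0; 0; 0; 0; -1; 0; 0; 0; 0; 0; 0]);
    (5884001546765260167273758321184912, [:: 0; 0; 1; 0; 0; 0; 0; -1; 0; 0; 0; 0; 0; 0]);
    (921870532121239123192078774664352, [:: 1; 2; -1; 2; -1; 1; 0; 1; 1; 1; 0; 1; 0; 1]);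
    (791508581966336722677022818081840, [:: 0; 0; 1; 0; 1; 0; 1; 1; 1; 0; 1; 0; 1; 0]);
    (6583182118208248670043428321363760, [:: 1; -3; 0; -3; 0; -1; 0; -1; 2; -1; 0; -1; 0; 0]);
    (3071629298302380828904772895215736, [:: 0; 3; -1; -3; 1; 0; 0; 0; 0; 1; 0; -1; 0; 0]);
    (2173842320840207756151124025017728, [:: 1; 1; 0; 1; 0; 0; 0; 1; 0; 0; 1; 0; 1; 0]);
    (5740253846242103912340541985635464, [:: 2; 2; 0; 2; 0; 0; 0; 2; 1; 1; 1; 1; 1; 1]);
    (5576941172078586784891920725161584, [:: 2; -1; 0; -1; 0; 0; 0; 0; 2; -1; 0; -1; 0; 0]);
    (735058465443098815265182171399944, [:: 3; -1; 1; -1; 1; -1; 1; 0; 2; -1; 0; -1; 0; -1]);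
    (3041163537859806497243083814238360, [:: 1; -1; 0; -1; 0; 0; 0; 1; 1; 0; 0; 0; 0; 0]);
    (690673032104174927411591896541808, [:: 0; 0; 0; 0; 0; 0; 0; 1; 0; 1; 1; 1; 1; 0]);
    (6483314846987739290095391618050056, [:: 0; 2; -1; 2; -1; 1; 0; 0; 0; 0; -1; 0; -1; 0]);
    (82975476460567356668615140295256, [:: 0; 1; 0; 1; 0; 0; 1; 1; 0; 1; 0; 1; 0; 0]);
    (24045519642183612688529969984083728, [:: 2; 1; 0; 1; 0; 0; 0; 1; 1; 0; 0; 0; 0; 0]);
    (3724407466887309798694733377629096, [:: 3; 1; -1; 1; -1; 0; -1; 2; 2; 0; 0; 0; 0; 0]);
    (6096449022287504410317083035682352, [:: 0; 1; 0; 1; 0; 0; 0; -1; 0; 0; 0; 0; 0; 0]);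
    (668670778917988581711468528644832, [:: 0; 0; 1; 0; 1; 1; -1; -1; 1; 2; 0; 2; 0; -3]);
    (293741235477961028975918813123160, [:: 1; 0; 2; 0; 2; -1; 1; -1; 1; -1; 1; -1; 1; 0]);
    (2919803873119883998130937330335808, [:: 0; 0; 0; 0; 0; 0; 1; 2; -1; 1; 1; 1; 1; 0]);
    (1841662766157279243076743583798152, [:: 1; 3; 0; 3; 0; 0; -1; 1; 0; 0; 1; 0; 1; 0]);
    (1280782125605849489002868074561392, [:: 0; 2; -1; -2; 1; 0; 0; 0; 0; 2; 1; -2; -1; 0])]);
  ([:: -1; -1; -1; 1; 1; 1], [::
    (7026235152176100042105600332260768, [:: 1; 0; 0; 0; 0; 0; 0; 0; 0; 0; 0; 0; 0; 0]);
    (8679045512611974618273639194882688, [:: 1; 1; 0; 0; 0; 0; 0; 0; 0; 0; 0; 0; 0; 0]);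
    (15418895439436199921397653882401176, [:: 0; 1; 0; 0; 0; 0; 0; -1; 0; 0; 0; 0; 0; 0]);
    (3102801711023920473694798737654168, [:: 0; 0; 1; 0; 0; 0; 0; 0; -1; 0; 0; 0; 0; 0]);
    (1073904219369375892238241707559328, [:: 1; 1; -1; 1; -1; 0; 1; 1; -1; 0; 1; 0; 1; -1]);
    (1321169251917995471409653546804928, [:: 0; 2; -2; 0; 0; 0; -1; -1; 2; 0; 0; 0; 1; 0]);
    (3767699510698334550796943313873216, [:: 0; 2; -1; 0; 0; 0; -1; -2; 1; 0; 0; 0; 1; 0]);
    (3642932307374351872380368834344032, [:: 0; 1; 0; 1; 0; 0; -1; 1; 0; 0; -1; 0; -1; 0]);
    (1664856581718050410714283807150568, [:: 0; 2; -1; 0; 0; 1; -2; -2; 1; 0; 0; -1; 2; 0]);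
    (2098952267469438869679569244600584, [:: 3; -1; -1; -1; -1; 0; 1; -1; -1; 0; 1; 0; 1; 0]);
    (4587399577166731389276847853899064, [:: 1; 2; -1; 2; -1; 0; 0; 2; -1; 0; 0; 0; 0; 0]);
    (3419124048551396371688644009508312, [:: 2; 3; -1; 3; -1; 1; 0; 3; -1; 1; 0; 1; 0; 1])]);
  ([:: 1; 1; -1; -1; 1; 1], [::
    (26266102752009837044992423873059816, [:: 1; 0; 0; -1; 0; 0; 0; 0; 0; 0; 0; 0; 0; 0]);
    (1653323865740490925451483688349209, [:: 1; -1; 0; -1; 0; 1; 1; 1; -1; 0; -1; 0; -1; 1]);
    (1264100947412841368658469586463780, [:: 2; -2; 0; -2; 0; 1; 0; 2; -1; 0; 0; 0; 0; 0]);
    (568435150744236293556695822924643, [:: 1; -1; 0; -1; 0; -1; -1; 1; 1; 0; 1; 0; 1; -1]);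
    (1574974587538713636152923438025766, [:: 2; 2; 1; 2; 1; 0; 0; 2; 0; 1; 0; 1; 0; 0]);
    (4648423387791882071616129778864668, [:: 2; 1; 1; -1; 0; 0; 0; -2; 0; 0; 0; -1; 0; 0])])]%BZ.

Definition swaps : seq (seq nat) :=
  [seq [seq (if i == e.1 then e.2 else if i == e.2 then e.1 else i) | i <- iota 0 6]
     | e <- pairs6].

(* Found greedily: after the transpositions, folding by these merges any two
   isomorphic monomials that occur. *)
Definition perms : seq (seq nat) := [::
  [:: 0; 1; 3; 2; 4; 5];
  [:: 1; 0; 2; 4; 5; 3];
  [:: 0; 2; 1; 3; 4; 5];
  [:: 1; 0; 2; 3; 5; 4];
  [:: 0; 2; 1; 4; 3; 5];
  [:: 1; 3; 0; 4; 2; 5];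
  [:: 0; 2; 3; 1; 4; 5];
  [:: 0; 1; 3; 2; 4; 5];
  [:: 0; 1; 5; 2; 3; 4];
  [:: 1; 2; 0; 5; 3; 4];
  [:: 0; 2; 1; 3; 4; 5];
  [:: 2; 4; 3; 5; 0; 1];
  [:: 1; 0; 2; 4; 3; 5];
  [:: 0; 3; 2; 1; 5; 4];
  [:: 0; 3; 4; 1; 2; 5];
  [:: 2; 0; 1; 5; 3; 4];
  [:: 0; 2; 3; 1; 4; 5];
  [:: 1; 0; 3; 2; 4; 5];
  [:: 2; 0; 5; 4; 1; 3];
  [:: 1; 4; 5; 0; 2; 3];
  [:: 0; 1; 3; 4; 2; 5];
  [:: 1; 0; 3; 5; 2; 4]].

(** A finite identity over [Z], settled by computation. Folding need not reach canonical forms: each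
    fold preserves averages, so an empty result is conclusive. *)
Lemma wheel_certified :
  certifies scale wheel_poly certificate (swaps ++ perms).
Proof. by vm_compute. Qed.

Local Open Scope ring_scope.

(** * Polynomials as weighted sums of monomials *)

Section ZToRing.
Variable R : numDomainType.

Definition of_Z (z : Z) : R := (int_of_Z z)%:~R.

Lemma of_ZD a b : of_Z (Z.add a b) = of_Z a + of_Z b.
Proof. by rewrite /of_Z (raddfD int_of_Z) intrD. Qed.

Lemma of_ZM a b : of_Z (Z.mul a b) = of_Z a * of_Z b.
Proof. by rewrite /of_Z (rmorphM int_of_Z) intrM. Qed.

Lemma of_ZN a : of_Z (Z.opp a) = - of_Z a.
Proof. by rewrite /of_Z (raddfN int_of_Z) intrN. Qed.

Lemma of_Z_ge0 z : Z.leb 0 z -> 0 <= of_Z z.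
Proof. by rewrite /of_Z ler0z; case: z. Qed.

Lemma of_Z_gt0 z : Z.ltb 0 z -> 0 < of_Z z.
Proof.
rewrite /of_Z ltr0z; case: z => //= p _.
by rewrite ltz_nat; apply/ssrnat.ltP/Pos2Nat.is_pos.
Qed.

End ZToRing.

Section Weights.
Variable R : numDomainType.
Implicit Type g : monomial -> R.

(** The linear extension of [g]. It covers both the value at one [x], with [g] the value of a
    monomial, and the sum over all [x], with [g] the sum of such values. *)
Definition wsum g (p : poly6) : R := \sum_(t <- p) of_Z R t.1 * g t.2.

Lemma wsum_nil g : wsum g [::] = 0.
Proof. exact: big_nil. Qed.

Lemma wsum_cons g t p : wsum g (t :: p) = of_Z R t.1 * g t.2 + wsum g p.
Proof. exact: big_cons. Qed.

Lemma wsum_cat g p q : wsum g (p ++ q) = wsum g p + wsum g q.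
Proof. exact: big_cat. Qed.

Lemma wsum_flatten g ps : wsum g (flatten ps) = \sum_(p <- ps) wsum g p.
Proof. by rewrite /wsum big_flatten. Qed.

Lemma wsum_scale g c p : wsum g (scalep c p) = of_Z R c * wsum g p.
Proof.
by rewrite /wsum big_map mulr_sumr; apply: eq_bigr => t _; rewrite of_ZM mulrA.
Qed.

Lemma wsum_terms_node g c l r :
  wsum g (terms (Node c l r)) =
    of_Z R c * g [::] + wsum (g \o cons false) (terms l)
                    + wsum (g \o cons true) (terms r).
Proof.
have E b h p : wsum h (consm b p) = wsum (h \o cons b) p.
  by rewrite /wsum big_map.
have H : wsum g (consm false (terms l) ++ consm true (terms r)) =
    wsum (g \o cons false) (terms l) + wsum (g \o cons true) (terms r).
  by rewrite wsum_cat !E.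
rewrite /=; case: Z.eqb_spec => [->|_].
  by rewrite H mul0r add0r.
by rewrite wsum_cons H addrA.
Qed.

Local Arguments terms : simpl never.

Lemma wsum_insert g c m t :
  wsum g (terms (insert c m t)) = of_Z R c * g m + wsum g (terms t).
Proof.
elim: m g t => [|b m IH] g [|c' l r] /=.
- by rewrite wsum_terms_node !wsum_nil !addr0.
- by rewrite !wsum_terms_node of_ZD mulrDl !addrA.
- by case: b; rewrite !wsum_terms_node mul0r IH !wsum_nil ?addr0 ?add0r.
- by case: b; rewrite !wsum_terms_node IH /=; ring.
Qed.

Lemma wsum_collect g p : wsum g (collect p) = wsum g p.
Proof.
(* The zero is written as the weight of [Leaf], so that the induction can run over an arbitrary
   accumulated trie. *)
rewrite /collect -[RHS]add0r -(wsum_nil g) -[[::]]/(terms Leaf).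
elim: p Leaf => [|t p IH] T /=; first by rewrite wsum_nil addr0.
by rewrite IH wsum_insert wsum_cons addrCA addrA.
Qed.

End Weights.

(** * Evaluation at a sign kernel *)

Lemma nth_xorm m1 m2 k :
  nth false (xorm m1 m2) k = nth false m1 k (+) nth false m2 k.
Proof.
elim: m1 m2 k => [|b1 m1 IH] [|b2 m2] [|k] //=; rewrite ?nth_nil ?addbF //.
Qed.

Definition sign_kernel (R : pzRingType) (V : Type) (f : V -> V -> R) : Prop :=
  (forall u v, f u v = f v u) /\ (forall u v, f u v ^+ 2 = 1).

Lemma sign_kernelN (R : pzRingType) (V : Type) (f : V -> V -> R) :
  sign_kernel f -> sign_kernel (fun u v => - f u v).
Proof. by case=> fC f2; split=> u v; rewrite ?sqrrN // fC. Qed.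

Section Evaluation.
Variables (R : realDomainType) (I V : finType) (vtx : nat -> I) (code : I -> nat).
Hypotheses (vtxK : {in gtn 6, cancel vtx code}) (codeK : cancel code vtx).
Hypothesis code_lt : forall i, is_true (code i < 6)%N.
Implicit Types (f : V -> V -> R) (x : {ffun I -> V}) (m : monomial) (p : poly6).

Definition edge f x k : R :=
  let e := nth (0, 0)%N pairs6 k in f (x (vtx e.1)) (x (vtx e.2)).

Definition mon f x m : R := \prod_(k < 15) edge f x k ^+ nth false m k.

Definition eval f x p : R := wsum (mon f x) p.

Lemma mon_nil f x : mon f x [::] = 1.
Proof. by rewrite /mon big1 // => k _; rewrite nth_nil. Qed.

Lemma mon_xorm f x m1 m2 : sign_kernel f ->
  mon f x (xorm m1 m2) = mon f x m1 * mon f x m2.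
Proof.
case=> _ f2; rewrite /mon -big_split /=; apply: eq_bigr => k _.
rewrite nth_xorm; case: (nth _ m1 k); case: (nth _ m2 k);
  by rewrite ?mul1r ?mulr1 //= expr0 expr1 -expr2 f2.
Qed.

Lemma eval_mulp f x p q : sign_kernel f ->
  eval f x (mulp p q) = eval f x p * eval f x q.
Proof.
move=> sf; rewrite /eval wsum_flatten big_map mulr_suml; apply: eq_bigr => s _.
rewrite /wsum big_map mulr_sumr; apply: eq_bigr => t _ /=.
by rewrite of_ZM mon_xorm //; ring.
Qed.

Lemma eval_prodp f x ps : sign_kernel f ->
  eval f x (prodp ps) = \prod_(p <- ps) eval f x p.
Proof.
move=> sf; elim: ps => [|p ps IH].
  by rewrite big_nil /eval wsum_cons wsum_nil mon_nil mulr1 addr0.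
by rewrite big_cons -IH -eval_mulp.
Qed.

Lemma mon_bit f x k : (k < 15)%N -> mon f x (bit k) = edge f x k.
Proof.
move=> k15; rewrite /mon (bigD1 (Ordinal k15)) //= big1 ?mulr1.
  by rewrite nth_ncons ltnn subnn.
move=> j; rewrite -val_eqE /= => jk.
rewrite nth_ncons; case: ltnP => // kj.
have: (0 < j - k)%N by rewrite subn_gt0 ltn_neqAle kj eq_sym jk.
by case: (j - k)%N => //= i _; rewrite nth_nil.
Qed.

Lemma eval_one_plus f x c k : (k < 15)%N ->
  eval f x (one_plus c k) = 1 + of_Z R c * edge f x k.
Proof.
by move=> ?; rewrite /eval !wsum_cons wsum_nil mon_nil mon_bit // addr0 mulr1.
Qed.

Lemma mon_pad f x m : mon f x (relabel (iota 0 15) m) = mon f x m.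
Proof.
apply: eq_bigr => k _.
by rewrite (nth_map 0%N) ?size_iota // nth_iota // add0n.
Qed.

Lemma mon_opp f x m :
  mon (fun u v => - f u v) x m = (-1) ^+ parity m * mon f x m.
Proof.
have -> : (-1) ^+ parity m = \prod_(k < 15) (-1) ^+ nth false m k :> R.
  rewrite /parity /relabel foldr_map -(big_mkord predT (fun k => (-1) ^+ nth false m k)).
  rewrite /index_iota subn0; elim: (iota 0 15) => [|k s IH]; first by rewrite big_nil.
  by rewrite big_cons /= signr_addb IH.
rewrite /mon -big_split /=; apply: eq_bigr => k _.
by rewrite -exprMn mulN1r.
Qed.

(** Passing from [f] to [-f] negates odd monomials and fixes even ones. *)
Lemma eval_even_part f x p :
  eval f x p + eval (fun u v => - f u v) x p = 2 * eval f x (even_part p).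
Proof.
rewrite /eval /wsum -big_split /= [in RHS]/even_part big_map big_filter mulr_sumr.
rewrite big_mkcond [RHS]big_mkcond /=; apply: eq_bigr => t _.
rewrite mon_opp mon_pad; case: (parity _) => /=; ring.
Qed.

(** Relabelling the vertices permutes the coordinates of [x], which is a bijection on the maps
    summed over. *)
Lemma sum_mon_relabel f s m : sign_kernel f -> valid_perm s ->
  \sum_x mon f x (relabel (on_pairs s) m) = \sum_x mon f x m.
Proof.
move=> [fC _] /and5P[/eqP s6 /allP slt su piu /allP pilt].
set pi := on_pairs s in piu pilt *.
have size_pi : size pi = 15%N by rewrite size_map.
have pi_lt (k : 'I_15) : (nth 0%N pi k < 15)%N.
  by apply: pilt; rewrite mem_nth // size_pi.
pose piI (k : 'I_15) := Ordinal (pi_lt k).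
have piI_inj : injective piI.
  move=> k l /(congr1 val) /= /eqP; rewrite nth_uniq ?size_pi //.
  by move=> /eqP /val_inj.
have s_lt i : (i < 6)%N -> (nth 0%N s i < 6)%N.
  by move=> i6; apply: slt; rewrite mem_nth // s6.
pose sigma i := vtx (nth 0%N s (code i)).
have sigma_inj : injective sigma.
  move=> i j /(congr1 code); rewrite !vtxK ?inE ?s_lt // => /eqP.
  by rewrite nth_uniq ?s6 // => /eqP /(can_inj codeK).
pose h x := [ffun i => x (sigma i)] : {ffun I -> V}.
have h_inj : injective h.
  move=> x y /ffunP xy; apply/ffunP => i.
  by have := xy (invF sigma_inj i); rewrite !ffunE f_invF.
rewrite (reindex_inj h_inj); apply: eq_bigr => x _.
rewrite /mon [RHS](reindex_inj piI_inj); apply: eq_bigr => k _.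
rewrite /relabel (nth_map 0%N) ?size_pi //; congr (_ ^+ _).
(* As [pi k < 15], the search in [pairs6] succeeded, so this pair is the image of pair [k] with its
   ends sorted. Symmetry of [f] later undoes the sorting. *)
have E : nth (0, 0)%N pairs6 (nth 0%N pi k) =
    (let e := nth (0, 0)%N pairs6 k in
     let i := nth 0%N s e.1 in let j := nth 0%N s e.2 in
     if (i < j)%N then (i, j) else (j, i)).
  have := pi_lt k; rewrite /pi /on_pairs (nth_map (0, 0)%N) // /pair_index.
  by rewrite -[15%N]/(size pairs6) index_mem; apply: nth_index.
rewrite /edge E; set e := nth _ pairs6 k.
have /allP e_lt : all (fun e => (e.1 < 6)%N && (e.2 < 6)%N) pairs6 by [].
have /andP[e1 e2] : (e.1 < 6)%N && (e.2 < 6)%N by apply/e_lt/mem_nth.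
rewrite /= !ffunE /sigma !vtxK //.
by case: ifP => _ //=; rewrite fC.
Qed.

Lemma sum_eval f p : \sum_x eval f x p = wsum (fun m => \sum_x mon f x m) p.
Proof.
rewrite exchange_big /=; apply: eq_bigr => t _.
by rewrite mulr_sumr.
Qed.

Lemma sum_eval_fold f s p : sign_kernel f -> valid_perm s ->
  \sum_x eval f x (fold_by s p) = \sum_x eval f x p.
Proof.
move=> sf vs; rewrite !sum_eval wsum_collect /wsum big_map.
by apply: eq_bigr => t _ /=; case: ifP => // _; rewrite sum_mon_relabel.
Qed.

Lemma sum_eval_folds f ss p : sign_kernel f -> all valid_perm ss ->
  \sum_x eval f x (foldl (fun p s => fold_by s p) p ss) = \sum_x eval f x p.
Proof.
move=> sf; elim: ss p => //= s ss IH p /andP[vs vss].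
by rewrite IH // sum_eval_fold.
Qed.

End Evaluation.

(** * Nonnegativity of the sums of squares *)

Section Update.
Variables (I V : finType).

Definition upd (x : {ffun I -> V}) (i : I) (y : V) : {ffun I -> V} :=
  [ffun j => if j == i then y else x j].

(** Exchanging [y] with the coordinate [x i] is an involution on the pairs [(x, y)]. *)
Lemma sum_upd (R : pzRingType) (i : I) (G : {ffun I -> V} -> R) :
  \sum_x \sum_y G (upd x i y) = #|V|%:R * \sum_x G x.
Proof.
pose h (p : {ffun I -> V} * V) := (upd p.1 i p.2, p.1 i).
have hK : involutive h.
  move=> [x y]; rewrite /h /= ffunE eqxx; congr (_, _).
  by apply/ffunP => j; rewrite !ffunE; case: eqP => // ->.
rewrite pair_big (reindex_inj (inv_inj hK)) /=.
rewrite (eq_bigr (fun p => G p.1)) => [|p _]; last first.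
  by congr G; apply: (congr1 fst (hK p)).
rewrite -(pair_big xpredT xpredT (fun x _ => G x)) mulr_sumr /=.
by apply: eq_bigr => x _; rewrite sumr_const mulr_natl.
Qed.

End Update.

Section SquareSum.
Variables (R : realDomainType) (I V : finType).

(* For fixed values of the other coordinates, summing over the coordinates [i]
   and [j] turns the product into a square. *)
Lemma sum_square_ge0 (i j : I) (w : {ffun I -> V} -> R)
    (A : {ffun I -> V} -> V -> R) : i != j ->
  (forall x k y, (k == i) || (k == j) -> w (upd x k y) = w x) ->
  (forall x k y u, (k == i) || (k == j) -> A (upd x k y) u = A x u) ->
  (forall x, 0 <= w x) ->
  0 <= \sum_x w x * (A x (x i) * A x (x j)).
Proof.
move=> ij wE AE w0.
have [V0|V0] := posnP #|V|.
  by rewrite big1 // => x _; have := max_card (pred1 (x i)); rewrite V0 card1.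
have n0 : 0 < #|V|%:R :> R by rewrite ltr0n.
(* Multiplying twice by [#|V|] introduces fresh values at [i] and [j], the two summation variables
   of the square. *)
rewrite -(pmulr_rge0 _ n0) -(sum_upd j) -(pmulr_rge0 _ n0) -(sum_upd i).
apply: sumr_ge0 => x _.
have -> : \sum_y \sum_z w (upd (upd x i y) j z) *
    (A (upd (upd x i y) j z) (upd (upd x i y) j z i) *
     A (upd (upd x i y) j z) (upd (upd x i y) j z j)) =
    w x * (\sum_y A x y) ^+ 2.
  rewrite expr2 mulr_suml mulr_sumr; apply: eq_bigr => y _.
  rewrite !mulr_sumr; apply: eq_bigr => z _.
  by rewrite !wE ?eqxx ?orbT // !AE ?eqxx ?orbT // !ffunE !eqxx (negPf ij).
by apply: mulr_ge0; rewrite ?sqr_ge0.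
Qed.

End SquareSum.

Section SumOfSquares.
Variables (R : realDomainType) (I V : finType) (vtx : nat -> I) (code : I -> nat).
Hypotheses (vtxK : {in gtn 6, cancel vtx code}).
Variable f : V -> V -> R.
Hypothesis sf : sign_kernel f.
Implicit Types (x : {ffun I -> V}) (v : seq Z).

Local Notation eval := (eval vtx f).

Lemma edge_sign x k : edge vtx f x k = 1 \/ edge vtx f x k = -1.
Proof.
case: sf => _ f2; rewrite /edge; set u := f _ _.
have /eqP : u ^+ 2 = 1 by rewrite f2.
by rewrite sqrf_eq1 => /orP[] /eqP; [left|right].
Qed.

Lemma eval_pattern x c :
  eval x (pattern c) = \prod_(k < 6) (1 + of_Z R (nth Z0 c k) * edge vtx f x k).
Proof.
rewrite eval_prodp // big_map.
rewrite -(big_mkord predT (fun k => 1 + of_Z R (nth Z0 c k) * edge vtx f x k)).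
rewrite /index_iota subn0; apply: eq_big_seq => k.
rewrite mem_iota add0n => /andP[_ k6]; rewrite eval_one_plus //.
exact: leq_trans k6 _.
Qed.

(** Edge values are signs and coefficients are [-1], [0] or [1], so each factor is [0], [1] or
    [2]. *)
Lemma pattern_ge0 x c : all (fun a => Z.leb (Z.abs a) 1) c ->
  0 <= eval x (pattern c).
Proof.
move=> /allP c1; rewrite eval_pattern; apply: prodr_ge0 => k _.
have : of_Z R (nth Z0 c k) \in [:: 1; 0; -1].
  have [kc|kc] := ltnP k (size c); last first.
    (* Past the end of [c] the default coefficient [0] gives the factor [1]. *)
    by rewrite nth_default // !inE eqxx orbT.
  have := c1 _ (mem_nth Z0 kc).
  by case: (nth _ _ _) => [|[]//|[]//] _; rewrite !inE ?eqxx ?orbT.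
by rewrite !inE => /or3P[] /eqP ->; case: (edge_sign x k) => -> ;
  rewrite ?mul0r ?mul1r ?mulN1r ?opprK ?addr0 ?subrr ?addr_ge0 ?ler01.
Qed.

(** The form [L x u] whose square is averaged, with coefficient vector [v]. *)
Definition form v x u : R :=
  \sum_(i <- iota 1 14) of_Z R (nth Z0 v i.-1) *
     \prod_(j < 4) f (x (vtx j)) u ^+ nth false (bits4 i) j.

Lemma eval_linear v x :
  (eval x (linear v 6) = form v x (x (vtx 4))) *
  (eval x (linear v 10) = form v x (x (vtx 5))).
Proof.
split; rewrite /eval /wsum big_map big_filter big_mkcond /=;
  apply: eq_bigr => i _;
  (case: Z.eqb_spec => [->|_] /=; first by rewrite mul0r);
  congr (_ * _); rewrite /mon !big_ord_recl !big_ord0 /= !mulr1 ?expr0 ?mul1r;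
  by rewrite /edge /= ?mulr1.
Qed.

Lemma vtx_upd x k y j : (k == vtx 4) || (k == vtx 5) -> (j < 4)%N ->
  upd x k y (vtx j) = x (vtx j).
Proof.
move=> k45 j4; rewrite ffunE; case: eqP => // jk; exfalso; move: k45; rewrite -jk.
have j6 : (j < 6)%N by apply: leq_trans j4 _.
by case/orP => /eqP /(congr1 code); rewrite !vtxK // => jE; rewrite jE in j4.
Qed.

(** The pattern and the form see only the vertices [0] to [3], so they are constant while the values
    at [vtx 4] and [vtx 5] vary. *)
Lemma sum_pattern_square_ge0 c v : all (fun a => Z.leb (Z.abs a) 1) c ->
  0 <= \sum_x eval x (pattern c) * eval x (square v).
Proof.
move=> c1.
under eq_bigr => x _ do rewrite [eval x (square v)]eval_mulp // !eval_linear.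
apply: (@sum_square_ge0 _ _ _ (vtx 4) (vtx 5)) => //.
- by apply/eqP => /(congr1 code); rewrite !vtxK.
- move=> x k y k45; rewrite !eval_pattern !big_ord_recl !big_ord0 /edge /=.
  by rewrite !vtx_upd.
- move=> x k y u k45; apply: eq_bigr => i _; congr (_ * _).
  by apply: eq_bigr => j _; rewrite vtx_upd.
- by move=> x; apply: pattern_ge0.
Qed.

Lemma sum_sos_ge0 cert : valid_sos cert -> 0 <= \sum_x eval x (sos cert).
Proof.
move=> /allP vc; rewrite sum_eval wsum_flatten big_map big_seq.
apply: sumr_ge0 => b /vc /andP[c1 /allP l0].
rewrite -sum_eval.
under eq_bigr => x _ do rewrite eval_mulp // [eval x (squares _)]wsum_collect
  wsum_flatten big_map mulr_sumr.
rewrite exchange_big big_seq; apply: sumr_ge0 => t /l0 t0.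
under eq_bigr => x _ do rewrite wsum_scale mulrCA.
by rewrite -mulr_sumr mulr_ge0 ?of_Z_ge0 // sum_pattern_square_ge0.
Qed.

End SumOfSquares.

(** * The wheel inequality for sign kernels *)

Section WheelInequality.
Variables (R : realDomainType) (I V : finType) (vtx : nat -> I) (code : I -> nat).
Hypotheses (vtxK : {in gtn 6, cancel vtx code}) (codeK : cancel code vtx).
Hypothesis code_lt : forall i, (code i < 6)%N.
Implicit Types (f : V -> V -> R) (x : {ffun I -> V}).

Lemma eval_wheel_poly f x : sign_kernel f ->
  eval vtx f x wheel_poly =
    \prod_(i < 5) (1 + f (x (vtx i)) (x (vtx (i.+1 %% 5)))) *
    \prod_(i < 5) (1 + f (x (vtx i)) (x (vtx 5))).
Proof.
move=> sf; have [fC _] := sf.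
have wheelE : wheel_pairs = [:: 0; 3; 5; 9; 6; 10; 11; 12; 13; 14]%N by [].
have -> : eval vtx f x wheel_poly =
    \prod_(k <- wheel_pairs) (1 + edge vtx f x k).
  rewrite /wheel_poly eval_prodp // big_map; apply: eq_big_seq => k k_in.
  rewrite eval_one_plus ?mul1r //.
  by move: k k_in; apply/allP; rewrite wheelE.
rewrite wheelE !big_cons !big_nil !big_ord_recl !big_ord0 /edge /=.
(* The rim pair closing the cycle is stored as [(0, 4)], but the product runs from [4] to [0]. *)
by rewrite [f (x (vtx 0)) (x (vtx 4))]fC ?mulr1 ?mulrA.
Qed.

(** The polynomial [d (p - 1) - sos cert] sums to zero over all [x] and both kernels [f] and [-f],
    because its even part folds to nothing. The sums of squares are nonnegative at both kernels. *)
Lemma certifies_sum_ge d p cert ss f : certifies d p cert ss -> sign_kernel f ->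
  2 * #|{: {ffun I -> V}}|%:R <=
  \sum_x (eval vtx f x p + eval vtx (fun u v => - f u v) x p).
Proof.
move=> /and4P[d_gt0 vsos vperms nt] sf; have sNf := sign_kernelN sf.
set N := fun u v => - f u v in sNf *.
pose q := scalep d p ++ [:: (Z.opp d, [::])] ++ scalep (Zneg xH) (sos cert).
have qE g x : eval vtx g x q = of_Z R d * (eval vtx g x p - 1)
     - eval vtx g x (sos cert).
  rewrite /eval /q !wsum_cat !wsum_scale wsum_cons wsum_nil mon_nil.
  by rewrite of_ZN mulN1r; ring.
have q0 : \sum_x (eval vtx f x q + eval vtx N x q) = 0.
  under eq_bigr => x _ do rewrite eval_even_part.
  rewrite -mulr_sumr -/(difference d p cert).
  have -> : \sum_x eval vtx f x (difference d p cert) = 0; last by rewrite mulr0.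
  transitivity (\sum_(x : {ffun I -> V})
    eval vtx f x (collect (difference d p cert))).
    by apply: eq_bigr => x _; rewrite /eval wsum_collect.
  rewrite -(sum_eval_folds vtxK codeK code_lt _ sf vperms).
  move: nt; case: foldl => // _.
  by rewrite big1 // => x _; rewrite /eval wsum_nil.
have sos_f := sum_sos_ge0 vtxK sf vsos.
have sos_N := sum_sos_ge0 vtxK sNf vsos.
have {}d_gt0 := of_Z_gt0 R d_gt0.
rewrite -subr_ge0 -(pmulr_rge0 _ d_gt0).
have : of_Z R d * (\sum_x (eval vtx f x p + eval vtx N x p) -
                 2 * #|{: {ffun I -> V}}|%:R) =
    \sum_x eval vtx f x (sos cert) + \sum_x eval vtx N x (sos cert).
  apply: subr0_eq; rewrite -[RHS]q0.
  have -> : #|{: {ffun I -> V}}|%:R = \sum_(x : {ffun I -> V}) (1 : R).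
    by rewrite sumr_const.
  rewrite [2 * _]mulr_sumr -sumrB mulr_sumr -big_split /= -sumrB.
  by apply: eq_bigr => x _; rewrite !qE; ring.
by move=> ->; apply: addr_ge0.
Qed.

Lemma sum_wheel_ge f : sign_kernel f ->
  2 * #|{: {ffun I -> V}}|%:R <=
  \sum_(x : {ffun I -> V})
    (\prod_(i < 5) (1 + f (x (vtx i)) (x (vtx (i.+1 %% 5)))) *
     \prod_(i < 5) (1 + f (x (vtx i)) (x (vtx 5))) +
     \prod_(i < 5) (1 - f (x (vtx i)) (x (vtx (i.+1 %% 5)))) *
     \prod_(i < 5) (1 - f (x (vtx i)) (x (vtx 5)))).
Proof.
move=> sf; apply: le_trans (certifies_sum_ge wheel_certified sf) _.
apply: ler_sum => x _; rewrite !eval_wheel_poly //.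
exact: sign_kernelN.
Qed.

End WheelInequality.

(** * Homomorphism densities of the wheel *)

(** Only spokes contain the hub. A rim edge determines its first end, since [ordS (ordS i) != i] on
    five points. *)
Lemma card_W5_edges : #|edges W5| = 10.
Proof.
have ordS_neq (i : 'I_5) : ordS i != i.
  by rewrite -val_eqE; case: i => [[|[|[|[|[|]]]]]].
have ordS2_neq (i : 'I_5) : ordS (ordS i) != i.
  by rewrite -val_eqE; case: i => [[|[|[|[|[|]]]]]].
rewrite /= /W5_edges cardsU !card_imset ?card_ord.
- rewrite (_ : _ :&: _ = finset.set0) ?cards0 //.
  apply/setP => e; rewrite !inE; apply/negP => /andP[].
  case/imsetP => i _ -> /imsetP[j _] /setP /(_ None).
  by rewrite !inE.
- move=> i j /setP /(_ (Some i)); rewrite !inE eqxx /=.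
  by move=> /esym/eqP[].
- move=> i j /setP ij; have := ij (Some i); have := ij (Some (ordS i)).
  rewrite !inE !eqxx orbT /= => /esym ji /esym.
  case/orP => [/eqP[] //|/eqP[] iE]; exfalso.
  move: ji; rewrite iE.
  by case/orP => /eqP/Some_inj/eqP; rewrite ?(negPf (ordS2_neq j)) ?(negPf (ordS_neq _)).
Qed.

Section Liminf.
Local Open Scope classical_set_scope.
Variable R : realType.

Lemma limn_einf_ge (u : nat -> \bar R) (a : R) :
  (forall e : R, 0 < e -> \forall n \near \oo, ((a - e)%:E <= u n)%E) ->
  (a%:E <= limn_einf u)%E.
Proof.
move=> au; rewrite limn_einf_lim; apply/lee_subgt0Pr => e e0.
apply: lime_ge; first exact: is_cvg_einfs.
have [N _ Nu] := au e e0.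
exists N => // n /= Nn; apply: le_ereal_inf_tmp => _ [k /= nk <-].
by apply: Nu; apply: leq_trans nk.
Qed.

End Liminf.

Section Density.
Variables (R : realType) (W : finType).
Implicit Types (G : sgraph W) (u v : W) (x : {ffun option 'I_5 -> W}).

Definition adj G u v : bool := [set u; v] \in edges G.

Definition sgn_adj G u v : R := if adj G u v then 1 else -1.

Lemma adj_compl G u v : adj (compl G) u v = (u != v) && ~~ adj G u v.
Proof. by rewrite /adj inE cards2; case: (u != v). Qed.

Lemma is_hom_W5 G x : is_hom W5 G x =
  [forall i, adj G (x (Some i)) (x (Some (ordS i)))] &&
  [forall i, adj G (x (Some i)) (x None)].
Proof.
have img a b : x @: [set a; b] = [set x a; x b].
  by rewrite imsetU1 imset_set1.
apply/forall_inP/andP => [H|[/forallP H1 /forallP H2] e].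
  split; apply/forallP => i; rewrite /adj.
    by rewrite -img; apply/H/setUP; left; apply: imset_f.
  by rewrite finset.setUC -img; apply/H/setUP; right; apply: imset_f.
by case/setUP => /imsetP[i _ ->]; rewrite img; [apply: H1|rewrite finset.setUC; apply: H2].
Qed.

Lemma sgn_adj_kernel G : sign_kernel (sgn_adj G).
Proof.
split=> u v; rewrite /sgn_adj; first by rewrite /adj finset.setUC.
by case: ifP => _; rewrite ?sqrrN expr1n.
Qed.

Lemma prod_bool n (b : 'I_n -> bool) :
  \prod_(i < n) (b i)%:R = [forall i, b i]%:R :> R.
Proof.
case: forallP => [b1|/forallP]; first by rewrite big1 // => i _; rewrite b1.
by rewrite negb_forall => /existsP[i /negPf bi]; rewrite (bigD1 i) //= bi mul0r.
Qed.

End Density.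

(** Rim [0] to [4] and hub [5], the numbering of [wheel_pairs]. *)
Definition W5_vertex (k : nat) : option 'I_5 :=
  if (k < 5)%N then Some (inord k) else None.

Definition W5_code (u : option 'I_5) : nat := if u is Some i then i : nat else 5.

Lemma W5_vertexK : {in gtn 6, cancel W5_vertex W5_code}.
Proof.
move=> k k6; rewrite /W5_vertex; case: ltnP => k5 /=; first by rewrite inordK.
by apply/eqP; rewrite eqn_leq k5.
Qed.

Lemma W5_codeK : cancel W5_code W5_vertex.
Proof. by case=> [i|]; rewrite /W5_vertex //= ltn_ord inord_val. Qed.

Lemma W5_code_lt u : (W5_code u < 6)%N.
Proof. by case: u => [i|] //=; apply: ltn_trans (ltn_ord i) _. Qed.

Lemma W5_vertexE (i : 'I_5) : W5_vertex i = Some i.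
Proof. by rewrite -[RHS]W5_codeK. Qed.

Section Density.
Variables (R : realType) (W : finType).
Implicit Types (G : sgraph W) (u v : W) (x : {ffun option 'I_5 -> W}).

Lemma is_hom_W5E G x :
  \prod_(i < 5) (1 + sgn_adj R G (x (Some i)) (x (Some (ordS i)))) *
  \prod_(i < 5) (1 + sgn_adj R G (x (Some i)) (x None)) =
  2 ^+ 10 * (is_hom W5 G x)%:R.
Proof.
have E u v : 1 + sgn_adj R G u v = 2 * (adj G u v)%:R.
  by rewrite /sgn_adj; case: (adj _ _ _); rewrite ?mulr1 ?mulr0 ?subrr.
rewrite is_hom_W5 -mulnb natrM -!prod_bool.
under eq_bigr do rewrite E.
under [X in _ * X]eq_bigr do rewrite E.
by rewrite !big_split /= !prodr_const !card_ord; ring.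
Qed.

(** These collapsed edges are the source of the error term: a loop has sign [-1], so its factor
    [1 - f] is [2], although it is no edge of the complement. *)
Definition coincidences x : nat :=
  (\sum_(i < 5) (x (Some i) == x (Some (ordS i)))
   + \sum_(i < 5) (x (Some i) == x None))%N.

(** Without coincidences, non-adjacency along [W5] is adjacency in the complement. Otherwise the
    count is at least [1] and dominates. *)
Lemma is_hom_W5_compl_ge G x :
  \prod_(i < 5) (1 - sgn_adj R G (x (Some i)) (x (Some (ordS i)))) *
  \prod_(i < 5) (1 - sgn_adj R G (x (Some i)) (x None)) <=
  2 ^+ 10 * ((is_hom W5 (compl G) x)%:R + (coincidences x)%:R).
Proof.
have E u v : 1 - sgn_adj R G u v = 2 * (~~ adj G u v)%:R.
  by rewrite /sgn_adj; case: (adj _ _ _); rewrite ?opprK ?mulr1 ?mulr0 ?subrr.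
under eq_bigr do rewrite E.
under [X in _ * X]eq_bigr do rewrite E.
rewrite !big_split /= !prodr_const !card_ord !prod_bool.
rewrite mulrACA -exprD ler_pM2l ?exprn_gt0 // -natrM mulnb -natrD ler_nat.
have [c0|] := eqVneq (coincidences x) 0%N; last first.
  by rewrite -lt0n => c0; rewrite (leq_trans (leq_b1 _)) // (leq_trans c0) // leq_addl.
move: c0 => /eqP; rewrite addn_eq0 !sum_nat_eq0 => /andP[/forallP c1 /forallP c2].
rewrite is_hom_W5; case: (boolP (_ && _)) => // /andP[/forallP H1 /forallP H2].
rewrite [X in (_ <= X + _)%N](_ : _ = 1%N) //; apply/eqP; rewrite eqb1.
apply/andP; split; apply/forallP => i; rewrite adj_compl.
  by rewrite H1 andbT; have := c1 i; rewrite eqb0.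
by rewrite H2 andbT; have := c2 i; rewrite eqb0.
Qed.

(** When the coordinate at [a] is resampled, exactly one value agrees with [x b]. *)
Lemma sum_coincidence (a b : option 'I_5) : a != b ->
  #|W|%:R * \sum_(x : {ffun option 'I_5 -> W}) (x a == x b)%:R =
    #|{: {ffun option 'I_5 -> W}}|%:R :> R.
Proof.
move=> ab; rewrite -(sum_upd a (fun x : {ffun _ -> W} => (x a == x b)%:R)).
rewrite -sum1_card natr_sum; apply: eq_bigr => x _.
rewrite (bigD1 (x b)) //= big1 ?addr0.
  by rewrite !ffunE eqxx [b == a]eq_sym (negPf ab) eqxx.
by move=> y yb; rewrite !ffunE eqxx [b == a]eq_sym (negPf ab) (negPf yb).
Qed.

Lemma sum_coincidences :
  #|W|%:R * \sum_x (coincidences x)%:R =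
  10 * #|{: {ffun option 'I_5 -> W}}|%:R :> R.
Proof.
under eq_bigr => x _ do rewrite natrD !natr_sum.
rewrite big_split /= mulrDr.
rewrite (exchange_big_dep xpredT) //= mulr_sumr.
rewrite [X in _ + _ * X](exchange_big_dep xpredT) //= mulr_sumr.
have ordS_neq (i : 'I_5) : Some i != Some (ordS i).
  by apply/eqP => -[] /eqP; case: i => [[|[|[|[|[|]]]]]].
under eq_bigr => i _ do rewrite sum_coincidence //.
under [X in _ + X]eq_bigr => i _ do rewrite sum_coincidence //.
by rewrite !sumr_const card_ord -mulrnDr mulr_natl.
Qed.

Lemma hom_densityE G (H : sgraph (option 'I_5)) :
  hom_density R H G =
  (\sum_x (is_hom H G x)%:R) / #|{: {ffun option 'I_5 -> W}}|%:R.
Proof.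
rewrite /hom_density; congr (_ / _).
by rewrite -sum1_card natr_sum big_mkcond /=; apply: eq_bigr => x _; rewrite inE; case: ifP.
Qed.

(** The loss is the expected number of coincidences: ten edges, each collapsed with probability
    [1 / #|W|]. *)
Lemma W5_density_ge G : (0 < #|W|)%N ->
  2 ^- 9 - 10 / #|W|%:R <= hom_density R W5 G + hom_density R W5 (compl G).
Proof.
move=> W0; have n0 : 0 < #|W|%:R :> R by rewrite ltr0n.
rewrite !hom_densityE; set N : R := #|{: {ffun option 'I_5 -> W}}|%:R.
have N0 : 0 < N by rewrite ltr0n card_ffun expn_gt0 W0.
rewrite -mulrDl ler_pdivlMr // mulrBl lerBlDr.
have -> : 10 / #|W|%:R * N = \sum_(x : {ffun option 'I_5 -> W}) (coincidences x)%:R.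
  by rewrite mulrAC -sum_coincidences mulrAC divff ?mul1r ?gt_eqF.
rewrite -(@ler_pM2l _ (2 ^+ 10)) ?exprn_gt0 // -addrA !mulrDr.
have -> : 2 ^+ 10 * (2 ^- 9 * N) = 2 * N.
  by rewrite mulrA exprS -(mulrA 2) divff ?mulr1 // expf_neq0 // pnatr_eq0.
apply: le_trans (sum_wheel_ge W5_vertexK W5_codeK W5_code_lt (sgn_adj_kernel R G)) _.
rewrite -!mulrDr -!big_split mulr_sumr /=; apply: ler_sum => x _.
have vE (i : 'I_5) : (W5_vertex i = Some i) * (W5_vertex (i.+1 %% 5) = Some (ordS i)).
  by split; [|rewrite -[RHS]W5_vertexE]; rewrite W5_vertexE.
under eq_bigr do rewrite !vE.
under [X in _ * X]eq_bigr do rewrite !vE.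
rewrite mulrDr is_hom_W5E lerD2l; under eq_bigr do rewrite !vE.
under [X in _ * X]eq_bigr do rewrite !vE.
exact: is_hom_W5_compl_ge.
Qed.

End Density.

Theorem theorem3p1 (R : realType) :
  common R W5 /\ 2 ^ (1 - #|edges W5|%:Z) = 2 ^- 9 :> R.
Proof.
have expE : 2 ^ (1 - #|edges W5|%:Z) = 2 ^- 9 :> R by rewrite card_W5_edges.
split=> //; rewrite /common expE; apply: limn_einf_ge => e e0.
near=> n; rewrite lee_fin /min_density.
(* The density bound holds for every graph, in particular for the minimizer. *)
set G := Order.arg_min _ _ _; rewrite /=.
have n0 : (0 < n)%N by near: n; exact: nbhs_infty_gt.
apply: le_trans (W5_density_ge R G _); rewrite card_ord //.
(* The error [10 / n] is at most [e] once [n >= 10 / e]. *)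
rewrite lerD2l lerN2 ler_pdivrMr ?ltr0n // mulrC -ler_pdivrMr //.
by near: n; exact: nbhs_infty_ger.
Unshelve. all: by end_near. Qed.
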